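(* Let $\nu$ be a Borel probability measure on $\mathbb{R}$ with support $\Omega\subseteq[0,1]$ which is an R-spectral measure, and let $q\ge1$ be an integer such that $q\mathcal{Z}_\nu\subseteq\mathbb{Z}$, where $\mathcal{Z}_\nu=\{\xi\in\mathbb{R}:\widehat\nu(\xi)=0\}$. Let $\mathcal{C}$ be a finite set of nonnegative integers, $P=\{p_c\}_{c\in\mathcal{C}}$ with $p_c>0$, $\sum_cp_c=1$, let $\eta=\sum_{c\in\mathcal{C}}p_c\delta_c$ and $\eta_q=\sum_{c\in\mathcal{C}}p_c\delta_{qc}$. Then $\mu=\eta_q*\nu$ is a spectral measure if and only if both $\eta$ and $\nu$ are spectral measures.
   Context: $\widehat\nu(\xi)=\int e^{2\pi i\xi x}d\nu(x)$. A probability measure $\rho$ is a spectral measure if $\{e^{2\pi i\lambda x}:\lambda\in\Lambda\}$ is an orthonormal basis of $L^2(\rho)$ for some countable $\Lambda$; it is an R-spectral measure if such a family is a Riesz basis (a basis that is also a frame) of $L^2(\rho)$. $*$ denotes convolution. *)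

(* Defs.v *)
From HB Require Import structures.
From mathcomp Require Import all_boot all_order all_algebra.
From mathcomp Require Import all_classical all_reals all_analysis.
Set Implicit Arguments. Unset Strict Implicit. Unset Printing Implicit Defensive.
Import Order.TTheory GRing.Theory Num.Theory.
Import numFieldNormedType.Exports.
Local Open Scope classical_set_scope.
Local Open Scope ring_scope.

(* Complex numbers are represented as pairs (real part, imaginary part);
   complex-valued functions on R as pairs of real functions. *)
Definition cfun (R : realType) := ((R -> R) * (R -> R))%type.

Section Defs.
Variable R : realType.
Implicit Types (rho : {measure set R -> \bar R}) (f g : cfun R) (Lam : set R).

Definition expo (l : R) : cfun R :=
  (fun x => cos (2 * pi * l * x), fun x => sin (2 * pi * l * x)).

Definition fourier rho (xi : R) : R * R :=
  (Rintegral rho setT (fun x => cos (2 * pi * xi * x)),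
   Rintegral rho setT (fun x => sin (2 * pi * xi * x))).

Definition cL2 rho f : Prop :=
  measurable_fun setT f.1 /\ measurable_fun setT f.2 /\
  rho.-integrable setT (fun x => (f.1 x ^+ 2 + f.2 x ^+ 2)%:E).

(* <f, g> = \int f \bar g d rho *)
Definition ip rho f g : R * R :=
  (Rintegral rho setT (fun x => f.1 x * g.1 x + f.2 x * g.2 x),
   Rintegral rho setT (fun x => f.2 x * g.1 x - f.1 x * g.2 x)).

Definition norm2 rho f : R :=
  Rintegral rho setT (fun x => f.1 x ^+ 2 + f.2 x ^+ 2).

Definition csqnorm (z : R * R) : R := z.1 ^+ 2 + z.2 ^+ 2.

Definition ae_zero rho f : Prop :=
  {ae rho, forall x, f.1 x = 0 /\ f.2 x = 0}.

Definition orthonormal_exp rho Lam : Prop :=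
  forall l l', Lam l -> Lam l' -> ip rho (expo l) (expo l') = ((l == l')%:R, 0).

Definition complete_exp rho Lam : Prop :=
  forall f, cL2 rho f -> (forall l, Lam l -> ip rho f (expo l) = (0, 0)) ->
  ae_zero rho f.

Definition spectral rho : Prop :=
  exists Lam : set R, countable Lam /\ orthonormal_exp rho Lam /\ complete_exp rho Lam.

Definition combo (F : seq R) (c : R -> R * R) : cfun R :=
  (fun x => \sum_(l <- F) ((c l).1 * cos (2 * pi * l * x) - (c l).2 * sin (2 * pi * l * x)),
   fun x => \sum_(l <- F) ((c l).1 * sin (2 * pi * l * x) + (c l).2 * cos (2 * pi * l * x))).

Definition csub f g : cfun R := (fun x => f.1 x - g.1 x, fun x => f.2 x - g.2 x).

(* f = sum_{l in Lam} c_l e_l, the series converging in L^2(rho)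
   (along the net of finite subsets of Lam) *)
Definition expands rho Lam f (c : R -> R * R) : Prop :=
  forall e : R, 0 < e -> exists F0 : seq R, (forall l, l \in F0 -> Lam l) /\
    forall F : seq R, uniq F -> (forall l, l \in F -> Lam l) -> {subset F0 <= F} ->
      norm2 rho (csub f (combo F c)) < e.

Definition basis_exp rho Lam : Prop :=
  forall f, cL2 rho f -> exists c, expands rho Lam f c /\
    forall c', expands rho Lam f c' -> forall l, Lam l -> c' l = c l.

Definition frame_exp rho Lam : Prop :=
  exists A B : R, 0 < A /\ 0 < B /\ forall f, cL2 rho f ->
    (((A * norm2 rho f)%R)%:E <= \esum_(l in Lam) (csqnorm (ip rho f (expo l)))%:E)%E /\
    (\esum_(l in Lam) (csqnorm (ip rho f (expo l)))%:E <= ((B * norm2 rho f)%R)%:E)%E.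

(* R-spectral: Riesz basis of exponentials (a basis that is also a frame) *)
Definition R_spectral rho : Prop :=
  exists Lam : set R, countable Lam /\ basis_exp rho Lam /\ frame_exp rho Lam.

Definition supp rho : set R :=
  [set x : R | forall r : R, (0 < r)%R -> (0 < rho [set y : R | (x - r < y < x + r)%R])%E].

Definition meas_conv (m1 m2 : {measure set R -> \bar R}) (A : set R) : \bar R :=
  (\int[m1]_t m2 [set (a - t)%R | a in A])%E.

End Defs.

(* Main.v *)
(* If {e_g : g in Gam} is a spectrum of eta and Lam, containing 0, is a spectrum
   of nu, then q Lam is a set of integers and Lam + Gam / q is a spectrum of mu:
   for f in L^2(mu) orthogonal to it, integrating first over the fibre
   c |-> f(q c + y) gives for each g in Gam a function of y orthogonal to Lam.

   Conversely let Lam be a spectrum of mu.  Since Z_nu is contained in Z / q,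
   two points of Lam lying in distinct classes modulo Z / q differ by a zero of
   xi |-> eta^(q xi), and two points of one class by a zero of nu^.  So q times a
   set of representatives is orthonormal for eta, and each class is orthonormal
   for nu.  For completeness, g in L^2(eta) and f in L^2(nu) produce F in
   L^2(mu) with <F, e_l> = <g, e_(q l)> <f, e_l>, so that F is orthogonal to Lam
   as soon as g or f is orthogonal to the relevant set.  The translates q c +
   [0, 1] overlap at endpoints when q = 1, so F is defined through the densities
   of the translates of nu with respect to mu.  Finally F = 0 forces g = 0 or
   f = 0: on q c + ]0, 1] with c the largest point where g does not vanish no
   smaller translate interferes, which kills f on ]0, 1]; the smallest such c
   kills f on [0, 1[. *)
Require Import Defs.
From HB Require Import structures.
From mathcomp Require Import all_boot all_order all_algebra.
From mathcomp Require Import all_classical all_reals all_analysis.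
From mathcomp Require Import measurable_realfun ring lra.
Set Implicit Arguments. Unset Strict Implicit. Unset Printing Implicit Defensive.
Import Order.TTheory GRing.Theory Num.Theory.
Local Open Scope classical_set_scope.
Local Open Scope ring_scope.

(** * Integrability and mixtures *)

Definition L1 {R : realType} (rho : {measure set R -> \bar R}) (u : R -> R) :=
  rho.-integrable setT (EFin \o u).

Definition L2 {R : realType} (rho : {measure set R -> \bar R}) (u : R -> R) :=
  measurable_fun setT u /\ L1 rho (fun x => u x ^+ 2).

Section integrals.
Context {R : realType}.
Implicit Types (rho : {measure set R -> \bar R}) (u v h : R -> R).

Lemma L1_measurable rho u : L1 rho u -> measurable_fun setT u.
Proof. by move=> /measurable_int /measurable_EFinP. Qed.

Lemma L1D rho u v : L1 rho u -> L1 rho v -> L1 rho (fun x => u x + v x).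
Proof. by move=> u1 v1; exact: (integrableD measurableT u1 v1). Qed.

Lemma L1B rho u v : L1 rho u -> L1 rho v -> L1 rho (fun x => u x - v x).
Proof. by move=> u1 v1; exact: (integrableB measurableT u1 v1). Qed.

Lemma L1Z rho u (k : R) : L1 rho u -> L1 rho (fun x => k * u x).
Proof. by move=> u1; exact: (integrableZl measurableT k u1). Qed.

Lemma L1Zr rho u (k : R) : L1 rho u -> L1 rho (fun x => u x * k).
Proof. by under [X in _ -> L1 _ X]eq_fun do rewrite mulrC; exact: L1Z. Qed.

Lemma L1_le rho u v : measurable_fun setT u -> (forall x, `|u x| <= v x) ->
  L1 rho v -> L1 rho u.
Proof.
move=> mu uv; apply: le_integrable => //; first exact/measurable_EFinP.
by move=> x _; rewrite lee_fin (le_trans (uv x))// ler_norm.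
Qed.

Lemma L1_sum rho (I : eqType) (s : seq I) (u : I -> R -> R) :
  (forall i, i \in s -> L1 rho (u i)) -> L1 rho (fun x => \sum_(i <- s) u i x).
Proof.
elim: s => [_|i s IH us].
  have -> : (fun x => \sum_(i <- [::]) u i x) = cst 0.
    by apply/funext => x; rewrite big_nil.
  exact: (integrable0 rho setT).
have -> : (fun x => \sum_(j <- i :: s) u j x) = (fun x => u i x + \sum_(j <- s) u j x).
  by apply/funext => x; rewrite big_cons.
apply: L1D; first by apply: us; rewrite mem_head.
by apply: IH => j js; apply: us; rewrite inE js orbT.
Qed.

Lemma Rint_sum rho (I : eqType) (s : seq I) (u : I -> R -> R) :
  (forall i, i \in s -> L1 rho (u i)) ->
  Rintegral rho setT (fun x => \sum_(i <- s) u i x) =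
  \sum_(i <- s) Rintegral rho setT (u i).
Proof.
elim: s => [_|i s IH us].
  rewrite big_nil (_ : (fun x => _) = cst 0); last first.
    by apply/funext => x; rewrite big_nil.
  by rewrite /Rintegral integral0_eq.
have us' j : j \in s -> L1 rho (u j) by move=> js; apply: us; rewrite inE js orbT.
rewrite big_cons -IH// -RintegralD//.
- by apply: eq_Rintegral => x _; rewrite big_cons.
- by apply: us; rewrite mem_head.
- exact: L1_sum.
Qed.

Lemma L1M_bounded rho u h (k : R) : measurable_fun setT h ->
  (forall x, `|h x| <= k) -> L1 rho u -> L1 rho (fun x => u x * h x).
Proof.
move=> mh hk u1; apply: (@L1_le _ _ (fun x => k * `|u x|)).
- by apply: measurable_funM => //; exact: L1_measurable u1.
- by move=> x; rewrite normrM mulrC ler_wpM2r.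
- apply: L1Z; exact: (integrable_norm u1).
Qed.

Lemma L2D rho u v : L2 rho u -> L2 rho v -> L2 rho (fun x => u x + v x).
Proof.
move=> [mu u2] [mv v2]; split; first exact: measurable_funD.
apply: (@L1_le _ _ (fun x => 2 * u x ^+ 2 + 2 * v x ^+ 2)).
- by apply: measurable_funX; exact: measurable_funD.
- move=> x; rewrite ger0_norm ?sqr_ge0//.
  by have := sqr_ge0 (u x - v x); rewrite sqrrB sqrrD; lra.
- by apply: L1D; exact: L1Z.
Qed.

Lemma L2M_bounded rho u h (k : R) : measurable_fun setT h ->
  (forall x, `|h x| <= k) -> L2 rho u -> L2 rho (fun x => u x * h x).
Proof.
move=> mh hk [mu u2]; split; first exact: measurable_funM.
have -> : (fun x => (u x * h x) ^+ 2) = (fun x => u x ^+ 2 * h x ^+ 2).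
  by apply/funext => x; rewrite exprMn.
apply: (@L1M_bounded _ _ _ (k ^+ 2)) => //; first exact: measurable_funX.
by move=> x; rewrite normrX lerXn2r ?nnegrE// (le_trans _ (hk x)).
Qed.

Lemma L2Z rho u (k : R) : L2 rho u -> L2 rho (fun x => u x * k).
Proof. by apply: (@L2M_bounded _ _ (cst k) `|k|). Qed.

Lemma L2_sum rho (I : eqType) (s : seq I) (u : I -> R -> R) :
  (forall i, i \in s -> L2 rho (u i)) -> L2 rho (fun x => \sum_(i <- s) u i x).
Proof.
elim: s => [_|i s IH us].
  have -> : (fun x => \sum_(i <- [::]) u i x) = cst 0.
    by apply/funext => x; rewrite big_nil.
  split; first exact: measurable_cst.
  have -> : (fun x => (cst 0 x) ^+ 2) = cst 0 :> (R -> R).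
    by apply/funext => x; rewrite expr0n.
  exact: (integrable0 rho setT).
have -> : (fun x => \sum_(j <- i :: s) u j x) = (fun x => u i x + \sum_(j <- s) u j x).
  by apply/funext => x; rewrite big_cons.
apply: L2D; first by apply: us; rewrite mem_head.
by apply: IH => j js; apply: us; rewrite inE js orbT.
Qed.

Lemma L1_bounded (rho : probability R R) u (k : R) : measurable_fun setT u ->
  (forall x, `|u x| <= k) -> L1 rho u.
Proof.
move=> mu uk; apply: (@L1_le _ _ (cst k)) => //.
by apply: finite_measure_integrable_cst.
Qed.

Lemma L2_L1 (rho : probability R R) u : L2 rho u -> L1 rho u.
Proof.
move=> [mu u2]; apply: (@L1_le _ _ (fun x => u x ^+ 2 + 1)) => //.
  by move=> x; rewrite ler_norml; have := sqr_ge0 (u x - 1);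
    have := sqr_ge0 (u x + 1); rewrite !expr2; nra.
apply: L1D => //; apply: (@L1_bounded _ _ 1) => //.
by move=> x; rewrite normr1.
Qed.

Lemma cL2E rho (f : cfun R) : cL2 rho f <-> L2 rho f.1 /\ L2 rho f.2.
Proof.
split=> [[m1 [m2 f2]]|[[m1 i1] [m2 i2]]].
  split; split=> //; apply: (L1_le _ _ f2) => [|x]; try exact: measurable_funX.
    by rewrite ger0_norm ?sqr_ge0// lerDl sqr_ge0.
  by rewrite ger0_norm ?sqr_ge0// lerDr sqr_ge0.
by do 2 split=> //; exact: L1D.
Qed.

Lemma L1_dirac (a : R) u : measurable_fun setT u -> L1 \d_a u.
Proof.
move=> mu; apply/integrableP; split; first exact/measurable_EFinP.
rewrite integral_dirac//=; last first.
  by apply/measurable_EFinP; exact: measurableT_comp.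
by rewrite diracT mul1e ltry.
Qed.

Lemma Rint_dirac (a : R) u : measurable_fun setT u -> Rintegral \d_a setT u = u a.
Proof.
by move=> mu; rewrite /Rintegral integral_dirac ?diracT ?mul1e//; exact/measurable_EFinP.
Qed.

Lemma mixture_ge0_integral rho (C : seq nat) (p : nat -> R)
    (m : nat -> {measure set R -> \bar R}) (f : R -> \bar R) :
  (forall c, c \in C -> 0 < p c) ->
  (forall A, measurable A -> rho A = (\sum_(c <- C) (p c)%:E * m c A)%E) ->
  measurable_fun setT f -> (forall x, (0 <= f x)%E) ->
  (\int[rho]_x f x = \sum_(c <- C) (p c)%:E * \int[m c]_x f x)%E.
Proof.
move=> p0 rhoE mf f0.
(* [mscale] wants a nonnegative weight at every index, also past the end of [C], where the sign of
   [p] is unknown; hence the absolute value. *)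
pose M n := mscale (NngNum (normr_ge0 (p (nth 0%N C n)))) (m (nth 0%N C n)).
have pE (i : 'I_(size C)) : `|p (nth 0%N C i)| = p (nth 0%N C i).
  by rewrite gtr0_norm// p0// mem_nth.
rewrite (eq_measure_integral (msum M (size C))) => [|A mA _]; last first.
  rewrite rhoE// /msum (big_nth 0%N) big_mkord; apply: eq_bigr => i _.
  by rewrite -[in LHS]pE.
rewrite ge0_integral_measure_sum// (big_nth 0%N) big_mkord.
by apply: eq_bigr => i _; rewrite ge0_integral_mscale//= pE.
Qed.

Lemma L1P rho u : L1 rho u <->
  measurable_fun setT u /\ (\int[rho]_x `|u x|%:E < +oo)%E.
Proof.
split=> [u1|[mu iu]]; last by apply/integrableP; split => //; exact/measurable_EFinP.
split; first exact: L1_measurable u1.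
by have /integrableP[_] := u1.
Qed.

Lemma mixture_L1 rho (C : seq nat) (p : nat -> R)
    (m : nat -> {measure set R -> \bar R}) u :
  (forall c, c \in C -> 0 < p c) ->
  (forall A, measurable A -> rho A = (\sum_(c <- C) (p c)%:E * m c A)%E) ->
  measurable_fun setT u ->
  L1 rho u <-> (forall c, c \in C -> L1 (m c) u).
Proof.
move=> p0 rhoE mu.
have mu' : measurable_fun setT (fun x => `|u x|%:E).
  by apply/measurable_EFinP; exact: (measurableT_comp (@normr_measurable _ setT)).
split.
  move=> /L1P[_]; rewrite (mixture_ge0_integral p0 rhoE)// => iu c cC.
  apply/L1P; split => //; rewrite ltNge leye_eq; apply/negP => /eqP iuy.
  (* One infinite term with positive weight makes the sum infinite, the others being nonnegative. *)
  move: iu; rewrite (big_rem c)//= iuy gt0_muley ?lte_fin ?p0//.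
  rewrite addye ?ltxx//.
  have : (0 <= \sum_(y <- rem c C) (p y)%:E * \int[m y]_x `|u x|%:E)%E.
    rewrite big_seq; apply: sume_ge0 => d /mem_rem dC.
    by rewrite mule_ge0 ?lee_fin ?(ltW (p0 _ _))//; apply: integral_ge0.
  by case: (\sum_(_ <- _) _)%E.
move=> u1; apply/L1P; split => //; rewrite (mixture_ge0_integral p0 rhoE)//.
rewrite big_seq; elim/big_ind: _ => //; first exact: lte_add_pinfty.
move=> c cC; rewrite lte_mul_pinfty ?lee_fin ?(ltW (p0 _ _))//.
by have /L1P[] := u1 c cC.
Qed.

Lemma RintE rho u : L1 rho u ->
  Rintegral rho setT u = Rintegral rho setT u^\+ - Rintegral rho setT u^\-.
Proof.
move=> u1; rewrite -RintegralB//.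
- by congr Rintegral; apply/esym/funrposBneg.
- by apply: integrable_funrpos.
- by apply: integrable_funrneg.
Qed.

(** Positive and negative parts reduce this to [mixture_ge0_integral]; integrability for each
    component keeps every term finite. *)
Lemma mixture_Rint rho (C : seq nat) (p : nat -> R)
    (m : nat -> {measure set R -> \bar R}) u :
  (forall c, c \in C -> 0 < p c) ->
  (forall A, measurable A -> rho A = (\sum_(c <- C) (p c)%:E * m c A)%E) ->
  L1 rho u ->
  Rintegral rho setT u = \sum_(c <- C) p c * Rintegral (m c) setT u.
Proof.
move=> p0 rhoE u1; have mu := L1_measurable u1.
have um := (mixture_L1 p0 rhoE mu).1 u1.
have ge0 v : (forall x, 0 <= v x) -> measurable_fun setT v ->
    (forall c, c \in C -> L1 (m c) v) ->
    Rintegral rho setT v = \sum_(c <- C) p c * Rintegral (m c) setT v.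
  move=> v0 mv vm; rewrite /Rintegral (mixture_ge0_integral p0 rhoE)//; last first.
    exact/measurable_EFinP.
  rewrite big_seq -sum_fine; last first.
    move=> c cC; rewrite fin_numM//; exact: integrable_fin_num (vm c cC).
  rewrite [RHS]big_seq; apply: eq_bigr => c cC; rewrite fineM//.
  exact: integrable_fin_num (vm c cC).
rewrite RintE// !ge0//.
- rewrite -sumrB big_seq [RHS]big_seq; apply: eq_bigr => c cC.
  by rewrite -mulrBr -RintE// um.
- exact: measurable_funrneg.
- by move=> c cC; apply: integrable_funrneg => //; exact: um.
- exact: measurable_funrpos.
- by move=> c cC; apply: integrable_funrpos => //; exact: um.
Qed.

End integrals.

(** * Translates and bounded densities *)

(** Named as a function so that it can be declared measurable, which [distribution] requires in
    [translate]. *)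
Definition translation {R : realType} (a y : R) : R := y + a.

Lemma measurable_translation {R : realType} (a : R) :
  measurable_fun setT (translation a).
Proof. exact: measurable_funD. Qed.

HB.instance Definition _ {R : realType} (a : R) :=
  isMeasurableFun.Build _ _ R R (translation a) (measurable_translation a).

Definition translate {R : realType} (nu : probability R R) (a : R) : probability R R :=
  distribution nu (translation a).

Section translates.
Context {R : realType}.
Implicit Types (nu mu sigma : probability R R) (u h : R -> R).

Lemma L1_translate nu (a : R) u : measurable_fun setT u ->
  L1 (translate nu a) u <-> L1 nu (fun y : R => u (y + a)).
Proof.
move=> mu; have mua : measurable_fun setT (fun y : R => u (y + a)).
  exact: (measurableT_comp mu (measurable_translation a)).
split=> /L1P[_ iu]; apply/L1P; split=> //; move: iu;
  rewrite ge0_integral_distribution//; apply/measurable_EFinP;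
  exact: (measurableT_comp (@normr_measurable _ setT)).
Qed.

Lemma Rint_translate nu (a : R) u : L1 (translate nu a) u ->
  Rintegral (translate nu a) setT u = Rintegral nu setT (fun y : R => u (y + a)).
Proof.
move=> u1; have mu := L1_measurable u1.
rewrite /Rintegral integral_distribution//; first exact/measurable_EFinP.
by move/(L1_translate _ _ mu) : u1.
Qed.

(** Integrating against finitely many Dirac masses samples the inner measure at the atoms. The
    convolution thereby becomes a mixture of translates of nu, the form used in all later
    arguments. *)
Lemma meas_convE (etaq nu mu : probability R R) (C : seq nat) (p : nat -> R) (a : nat -> R) :
  (forall c, c \in C -> 0 < p c) ->
  (forall A, measurable A -> etaq A = (\sum_(c <- C) (p c)%:E * \d_(a c) A)%E) ->
  (forall A, measurable A -> mu A = meas_conv etaq nu A) ->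
  forall A, measurable A -> mu A = (\sum_(c <- C) (p c)%:E * translate nu (a c) A)%E.
Proof.
move=> p0 etaE muE A mA; rewrite muE// /meas_conv.
have imE t : [set s - t | s in A] = translation t @^-1` A.
  apply/seteqP; split=> [_ [s As <-]|y Ay]; first by rewrite /= /translation subrK.
  by exists (y + t) => //; rewrite addrK.
have mimA t : measurable (translation t @^-1` A).
  by rewrite -[X in measurable X]setTI; exact: measurable_translation.
rewrite (eq_integral (fun t => nu (translation t @^-1` A))); last first.
  by move=> t _; rewrite imE.
have mf : measurable_fun setT (fun t => nu (translation t @^-1` A)).
  (* The function of t is the measure of the sections of this plane set, hence measurable. *)
  pose B : set (R * R) := (fun z => z.2 + z.1) @^-1` A.
  have mB : measurable B.
    rewrite -[X in measurable X]setTI.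
    have : measurable_fun setT (fun z : R * R => z.2 + z.1).
      exact: measurable_funD measurable_snd measurable_fst.
    exact.
  have := measurable_fun_xsection nu mB.
  congr (measurable_fun _ _); apply/funext => t /=; congr (nu _).
  by apply/seteqP; split => y /=; rewrite /xsection /= in_setE.
rewrite (@mixture_ge0_integral _ etaq C p (fun c => \d_(a c)))//.
by apply: eq_bigr => c _; rewrite integral_dirac// diracT mul1e.
Qed.

(** The Radon-Nikodym density is at most k almost everywhere; truncating it at k makes the bound
    hold at every point. *)
Lemma bounded_density (sigma mu : probability R R) (k : R) : 0 < k ->
  (forall A, measurable A -> (sigma A <= k%:E * mu A)%E) ->
  exists r : R -> R, [/\ measurable_fun setT r, (forall x, 0 <= r x <= k) &
    forall u, L1 sigma u -> L1 mu (fun x => u x * r x) /\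
      Rintegral mu setT (fun x => u x * r x) = Rintegral sigma setT u].
Proof.
move=> k0 smu; pose f := Radon_Nikodym_SigmaFinite.f sigma mu.
have dom : sigma `<< mu.
  apply/null_content_dominatesP => A mA muA; apply/eqP.
  by rewrite eq_le measure_ge0 andbT (le_trans (smu A mA))// muA mule0.
have f0 x : (0 <= f x)%E by exact: Radon_Nikodym_SigmaFinite.f_ge0.
have ffin x : f x \is a fin_num by exact: Radon_Nikodym_SigmaFinite.f_fin_num.
have fint : mu.-integrable setT f by exact: Radon_Nikodym_SigmaFinite.f_integrable.
pose g x := fine (f x).
have fE x : f x = (g x)%:E by rewrite fineK.
have mg : measurable_fun setT g.
  by apply/measurable_EFinP; rewrite (_ : EFin \o g = f)//;
    [exact: measurable_int fint|apply/funext => x; rewrite /= fE].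
have g0 x : 0 <= g x by rewrite -lee_fin -fE.
have mr : measurable_fun setT (fun x => Num.min (g x) k) by exact: measurable_minr.
(* For A inside E, k mu(A) <= int_A g = sigma(A) <= k mu(A), so g = k almost everywhere on E; since
   g > k there, E is null. *)
pose E : set R := [set x | k < g x].
have mE : measurable E.
  rewrite (_ : E = g @^-1` `]k, +oo[%classic).
    by rewrite -[X in measurable X]setTI; exact: mg.
  by apply/seteqP; split => x; rewrite /E /= in_itv/= andbT.
have muE : mu E = 0%E.
  have gint : mu.-integrable E (EFin \o g).
    by rewrite (_ : EFin \o g = f); [exact: integrableS fint|apply/funext => x; rewrite /= fE].
  have := @integral_ae_eq _ _ _ mu E mE (cst k%:E) (EFin \o g) gint.
  case=> // [A AE mA|N [mN N0 subN]].
    apply/eqP; rewrite eq_le; apply/andP; split.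
      rewrite integral_cst//; apply: le_trans (smu A mA).
      rewrite (Radon_Nikodym_SigmaFinite.f_integral dom)//.
      by rewrite (eq_integral f)// => x _; rewrite fE.
    apply: ge0_le_integral => //.
    - by move=> x Ax; rewrite /cst lee_fin ltW.
    - exact/measurable_EFinP/measurable_funTS.
    - by move=> x /AE /ltW; rewrite lee_fin.
  apply: (subset_measure0 mE mN) => // x Ex; apply: subN => /= /(_ Ex)[gk].
  by move: Ex; rewrite /E /= gk ltxx.
have rg : ae_eq mu setT (fun x => (Num.min (g x) k)%:E) f.
  exists E; split=> // x /= ngk; rewrite /E /= ltNge; apply/negP => gk.
  by apply: ngk => _; rewrite fE min_l.
have pos (v : R -> R) : measurable_fun setT v -> (forall x, 0 <= v x) ->
    (\int[mu]_x (v x * Num.min (g x) k)%:E = \int[sigma]_x (v x)%:E)%E.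
  move=> mv v0; have mv' : measurable_fun setT (EFin \o v) by exact/measurable_EFinP.
  rewrite -(Radon_Nikodym_SigmaFinite.change_of_variables dom)//.
  apply: ae_eq_integral => //.
  - by apply/measurable_EFinP; exact: measurable_funM.
  - by apply: emeasurable_funM => //; exact: measurable_int fint.
  - exact: (ae_eqe_mul2l (EFin \o v) rg).
have L1pos (v : R -> R) : L1 sigma v -> (forall x, 0 <= v x) -> L1 mu (fun x => v x * Num.min (g x) k).
  move=> v1 v0; have mv := L1_measurable v1.
  apply/L1P; split; first exact: measurable_funM.
  have /L1P[_] := v1; under eq_integral do rewrite ger0_norm//.
  rewrite -pos//; under eq_integral => x _.
    rewrite -[X in (X%:E)%E]ger0_norm; last by rewrite mulr_ge0// le_min g0 ltW.
    over.
  by [].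
exists (fun x => Num.min (g x) k); split => //.
  by move=> x; rewrite le_min g0 (ltW k0) ge_min lexx orbT.
move=> u u1; have mu_ := L1_measurable u1.
have up : L1 sigma u^\+ by exact: integrable_funrpos.
have un : L1 sigma u^\- by exact: integrable_funrneg.
have uE x : u x * Num.min (g x) k = u^\+ x * Num.min (g x) k - u^\- x * Num.min (g x) k.
  by rewrite -mulrBl; congr (_ * _); have /(congr1 (fun h => h x)) := funrposBneg u.
have upr := L1pos _ up (funrpos_ge0 u).
have unr := L1pos _ un (funrneg_ge0 u).
split.
  have := integrableB measurableT upr unr; congr (integrable _ _ _).
  by apply/funext => x; rewrite /= uE EFinB.
under eq_Rintegral do rewrite uE.
rewrite RintegralB// [RHS]RintE//; congr (_ - _); congr fine; apply: pos => //.
- exact: measurable_funrpos.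
- exact: measurable_funrneg.
Qed.

End translates.

(** * Functions assembled from translates, and almost-everywhere vanishing *)

Section transfer.
Context {R : realType}.
Implicit Types (nu mu : probability R R) (u h : R -> R).

(** A point outside the support has a null neighbourhood, hence lies in a null interval with
    rational endpoints, and there are countably many of these. *)
Lemma ae_supp nu : supp nu `<=` [set x : R | 0 <= x <= 1] ->
  {ae nu, forall y, 0 <= y <= 1}.
Proof.
move=> snu.
(* The integer n codes a pair of rational endpoints; intervals of positive mass are replaced by the
   empty set, so that every [F n] is negligible. *)
pose F n : set R := if unpickle n is Some ab then
  let I := `]ratr ab.1, ratr ab.2[%classic in if nu I == 0%E then I else set0
  else set0.
have Fneg n : nu.-negligible (F n).
  rewrite /F; case: unpickle => [[a b]|]; last exact: negligible_set0.
  case: eqP => [I0|_]; last exact: negligible_set0.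
  exact/negligibleP.
apply: negligibleS (negligible_bigcup Fneg) => x /= nx.
have /existsNP[r /not_implyP[r0 /negP]] : ~ supp nu x by move=> /snu.
rewrite -leNgt => nu0.
have /rat_in_itvoo[a] : x - r < x by rewrite gtrBl.
rewrite in_itv/= => /andP[ra ax].
have /rat_in_itvoo[b] : x < x + r by rewrite ltrDl.
rewrite in_itv/= => /andP[xb br].
exists (pickle (a, b)); first exact: I.
rewrite /F pickleK; cbv beta iota zeta delta [fst snd].
have -> : nu `]ratr a, ratr b[%classic = 0%E.
  apply/eqP; rewrite eq_le measure_ge0 andbT; apply: le_trans nu0.
  have seE : [set y | x - r < y < x + r] = `]x - r, x + r[%classic.
    by apply/seteqP; split=> y; rewrite /= in_itv.
  rewrite seE; apply: le_measure; rewrite ?inE// => y; rewrite /= !in_itv/=.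
  by move=> /andP[ay yb]; rewrite (lt_trans ra ay) (lt_trans yb br).
by rewrite eqxx; apply/andP.
Qed.

(* F mu is the sum over c of the images of u_c nu under y |-> y + t c. *)
Lemma transfer nu mu (C : seq nat) (p t : nat -> R) (u : nat -> R -> R) :
  (forall c, c \in C -> 0 < p c) ->
  (forall A, measurable A ->
    mu A = (\sum_(c <- C) (p c)%:E * translate nu (t c) A)%E) ->
  (forall c, c \in C -> L2 nu (u c)) ->
  exists2 F, L2 mu F & forall h k, measurable_fun setT h ->
    (forall x, `|h x| <= k) ->
    Rintegral mu setT (fun x => F x * h x) =
    \sum_(c <- C) Rintegral nu setT (fun y => u c y * h (y + t c)).
Proof.
move=> p0 muE u2.
(* Since mu dominates p_c times the translate of nu, that translate has a density at most 1 / p_c.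
   The zero function serves for c outside [C], so that a choice can be made for all c. *)
have dens c : exists r : R -> R, c \in C -> [/\ measurable_fun setT r,
    (forall x, 0 <= r x <= (p c)^-1) &
    forall v, L1 (translate nu (t c)) v -> L1 mu (fun x => v x * r x) /\
      Rintegral mu setT (fun x => v x * r x) =
      Rintegral (translate nu (t c)) setT v].
  have [cC|] := boolP (c \in C); last by exists (cst 0).
  have pc := p0 c cC.
  have [|A mA|r rP] := @bounded_density R (translate nu (t c)) mu (p c)^-1.
  - by rewrite invr_gt0.
  - rewrite -[leLHS]mul1e -(mulVf (lt0r_neq0 pc)) EFinM -muleA.
    rewrite lee_wpmul2l ?lee_fin ?invr_ge0 ?(ltW pc)// muE//.
    rewrite (big_rem c)//= leeDl// big_seq; apply: sume_ge0 => d /mem_rem dC.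
    by rewrite mule_ge0// lee_fin (ltW (p0 d dC)).
  - by exists r.
have {dens} [r rP] := choice dens.
pose G c (x : R) := u c (x - t c).
have GK c (y : R) : G c (y + t c) = u c y by rewrite /G addrK.
have mG c : c \in C -> measurable_fun setT (G c).
  move=> cC; have [mu_ _] := u2 c cC.
  exact: (measurableT_comp mu_ (measurable_translation (- t c))).
exists (fun x => \sum_(c <- C) G c x * r c x).
  apply: L2_sum => c cC; have [mr rb rint] := rP c cC.
  split; first by apply: measurable_funM => //; exact: mG.
  have G1 : L1 (translate nu (t c)) (fun x => G c x ^+ 2).
    apply/L1_translate; first by apply: measurable_funX; exact: mG.
    under eq_fun do rewrite /= GK.
    by have [_] := u2 c cC.
  have [Gr1 _] := rint _ G1.
  (* One factor r_c is the density making G_c^2 r_c integrable for mu; the other is merely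
     bounded. *)
  have -> : (fun x => (G c x * r c x) ^+ 2) = (fun x => G c x ^+ 2 * r c x * r c x).
    by apply/funext => x; ring.
  apply: (@L1M_bounded _ _ _ _ (p c)^-1) => // x.
  by have /andP[r0 rk] := rb x; rewrite ger0_norm.
move=> h k mh hk.
have uh1 c : c \in C -> L1 (translate nu (t c)) (fun x => G c x * h x).
  move=> cC; apply/L1_translate; first by apply: measurable_funM => //; exact: mG.
  under eq_fun do rewrite /= GK.
  apply: (@L1M_bounded _ _ _ _ k) => //.
    exact: (measurableT_comp mh (measurable_translation (t c))).
  exact/L2_L1/u2.
under eq_Rintegral do rewrite mulr_suml.
rewrite Rint_sum.
  rewrite big_seq [RHS]big_seq; apply: eq_bigr => c cC.
  have [_ _ rint] := rP c cC; have [_ rE] := rint _ (uh1 c cC).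
  under eq_Rintegral do rewrite mulrAC.
  rewrite rE Rint_translate; last exact: uh1.
  by apply: eq_Rintegral => y _; rewrite GK.
move=> c cC; have [_ _ rint] := rP c cC; have [+ _] := rint _ (uh1 c cC).
by under eq_fun do rewrite mulrAC.
Qed.

Lemma ae_Rint0 nu u : measurable_fun setT u -> {ae nu, forall y, u y = 0} ->
  Rintegral nu setT u = 0.
Proof.
move=> mu u0; rewrite /Rintegral (ae_eq_integral (cst 0%E))//.
- by rewrite integral0.
- exact/measurable_EFinP.
- by apply: filterS u0 => y /= -> _.
Qed.

Lemma ae_vanish (nu : probability R R) u (S : set R) : L1 nu u -> measurable S ->
  (forall E, measurable E -> E `<=` S ->
    Rintegral nu setT (fun y => u y * \1_E y) = 0) ->
  {ae nu, forall y, S y -> u y = 0}.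
Proof.
move=> u1 mS uE.
have mu_ := L1_measurable u1.
suff : ae_eq nu S (EFin \o u) (cst 0%E).
  by apply: filterS => y /= h /h [].
apply: integral_ae_eq => //; first exact: integrableS u1.
move=> E ES mE; rewrite integral0.
have uE1 : L1 nu (fun y => u y * \1_E y).
  apply: (@L1M_bounded _ _ _ _ 1) => //.
  by move=> x; rewrite indicE; case: (_ \in _); rewrite ?normr1 ?normr0.
have : (\int[nu]_y (u y * \1_E y)%:E = 0)%E.
  rewrite -[LHS]fineK; last exact: integrable_fin_num uE1.
  by congr EFin; exact: uE.
move=> <-; rewrite integral_mkcond; apply: eq_integral => x _.
by rewrite patchE indicE; case: (_ \in _); rewrite ?mulr1 ?mulr0.
Qed.

(** To isolate [u c0], test on B = E + t c0 with E inside S: for any other c, at almost every y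
    either [u c] vanishes or y + t c misses B. *)
Lemma translates_cancel nu (C : seq nat) (t : nat -> R) (u : nat -> R -> R)
    (c0 : nat) (S : set R) :
  uniq C -> (forall c, c \in C -> L1 nu (u c)) ->
  (forall B, measurable B ->
    \sum_(c <- C) Rintegral nu setT (fun y => u c y * \1_B (y + t c)) = 0) ->
  c0 \in C -> measurable S ->
  (forall c, c \in C -> c != c0 ->
    {ae nu, forall y, u c y = 0 \/ ~ S (y + t c - t c0)}) ->
  {ae nu, forall y, S y -> u c0 y = 0}.
Proof.
move=> uC u1 uB c0C mS other; apply: ae_vanish => //; first exact: u1.
move=> E mE ES.
pose B := translation (- t c0) @^-1` E.
have mB : measurable B.
  by rewrite -[X in measurable X]setTI; exact: measurable_translation.
have := uB B mB; rewrite (bigD1_seq c0)//= big_seq_cond big1 ?addr0.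
  move=> <-; apply: eq_Rintegral => y _; congr (_ * _).
  rewrite !indicE; congr (nat_of_bool _)%:R.
  by apply/idP/idP; rewrite !in_setE /B /= /translation addrK.
move=> c /andP[cC cc0]; apply: ae_Rint0.
  apply: measurable_funM; first exact: L1_measurable (u1 c cC).
  by apply: (measurableT_comp _ (measurable_translation (t c))).
apply: filterS (other c cC cc0) => y [->|nS]; first by rewrite mul0r.
rewrite indicE memNset ?mulr0// => By; apply: nS; exact: ES.
Qed.

End transfer.

(** * Exponentials *)

Definition cmul {R : realType} (z w : R * R) : R * R :=
  (z.1 * w.1 - z.2 * w.2, z.1 * w.2 + z.2 * w.1).

Section exponentials.
Context {R : realType}.
Implicit Types (rho : probability R R) (f g : cfun R) (Lam : set R).

(** The squared modulus is multiplicative, and a sum of two squares vanishes only if both squares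
    do. *)
Lemma cmul_eq0 (z w : R * R) : cmul z w = (0, 0) <-> z = (0, 0) \/ w = (0, 0).
Proof.
case: z w => [a b] [c d]; rewrite /cmul/=; split; last first.
  by case=> [][-> ->]; rewrite ?mul0r ?mulr0 subr0 addr0.
move=> [h1 h2].
have : (a ^+ 2 + b ^+ 2) * (c ^+ 2 + d ^+ 2) = 0.
  transitivity ((a * c - b * d) ^+ 2 + (a * d + b * c) ^+ 2); first by ring.
  by rewrite h1 h2 expr0n addr0.
have sq (x y : R) : x ^+ 2 + y ^+ 2 = 0 -> (x, y) = (0, 0).
  move=> /eqP; rewrite paddr_eq0 ?sqr_ge0// !sqrf_eq0 => /andP[/eqP-> /eqP->].
  by [].
by move=> /eqP; rewrite mulf_eq0 => /orP[] /eqP /sq; [left|right].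
Qed.

Lemma cos_int (x : R) (z : int) : cos (x + 2 * pi * z%:~R) = cos x.
Proof.
have E (n : nat) (y : R) : cos (y + 2 * pi * n%:R) = cos y.
  by rewrite -(periodicn (@cosD2pi R) n y); congr (cos (y + _)); ring.
case: z => n; first exact: E.
(* A negative integer has the form -(n + 1), so n + 1 periods bring the argument back to x. *)
by rewrite -[LHS](E n.+1) NegzE mulrNz -pmulrn; congr cos; ring.
Qed.

Lemma sin_int (x : R) (z : int) : sin (x + 2 * pi * z%:~R) = sin x.
Proof.
have E (n : nat) (y : R) : sin (y + 2 * pi * n%:R) = sin y.
  by rewrite -(periodicn (@sinD2pi R) n y); congr (sin (y + _)); ring.
case: z => n; first exact: E.
by rewrite -[LHS](E n.+1) NegzE mulrNz -pmulrn; congr sin; ring.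
Qed.

Lemma measurable_cosl (l : R) : measurable_fun setT (fun x : R => cos (l * x)).
Proof.
apply: (measurableT_comp (f := cos)); last exact: measurable_funM.
by apply: continuous_measurable_fun; exact: continuous_cos.
Qed.

Lemma measurable_sinl (l : R) : measurable_fun setT (fun x : R => sin (l * x)).
Proof.
apply: (measurableT_comp (f := sin)); last exact: measurable_funM.
by apply: continuous_measurable_fun; exact: continuous_sin.
Qed.

Lemma ip_expo rho (l l' : R) : ip rho (expo l) (expo l') = fourier rho (l - l').
Proof.
rewrite /ip /fourier; congr pair; apply: eq_Rintegral => x _ /=.
  by rewrite -cosB; congr cos; ring.
by rewrite -sinB; congr sin; ring.
Qed.

Lemma fourier0 rho : fourier rho 0 = (1, 0).
Proof.
rewrite /fourier; congr pair.
  under eq_Rintegral do rewrite mulr0 mul0r cos0.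
  by rewrite Rintegral_cst// mul1r (congr1 fine (probability_setT rho)).
under eq_Rintegral do rewrite mulr0 mul0r sin0.
by rewrite Rintegral_cst// mul0r.
Qed.

(** Exponentials have norm 1 for a probability measure, so only distinct frequencies impose a
    condition. *)
Lemma orthonormal_expP rho Lam : orthonormal_exp rho Lam <->
  (forall l l', Lam l -> Lam l' -> l != l' -> fourier rho (l - l') = (0, 0)).
Proof.
split=> [on l l' Ll Ll' /negbTE ll'|on l l' Ll Ll'].
  by rewrite -ip_expo on// ll'.
rewrite ip_expo; have [->|ll'] := eqVneq l l'; first by rewrite subrr fourier0.
exact: on.
Qed.

Lemma cL2_expo rho (l : R) : cL2 rho (expo l).
Proof.
apply/cL2E; split; split; rewrite /=.
- exact: measurable_cosl.
- apply: (@L1_bounded _ _ _ 1); first exact: measurable_funX (measurable_cosl _).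
  by move=> x; rewrite normrX expr_le1// cos_max.
- exact: measurable_sinl.
- apply: (@L1_bounded _ _ _ 1); first exact: measurable_funX (measurable_sinl _).
  by move=> x; rewrite normrX expr_le1// sin_max.
Qed.

(** An exponential has modulus 1 everywhere and the measure has mass 1. *)
Lemma ae_zero_expo rho (l : R) : ~ ae_zero rho (expo l).
Proof.
move=> /filter_ex[|x/=[c0 s0]].
  by apply: ae_properfilter_algebraOfSetsType;
    rewrite [X in (_ < X)%E](probability_setT rho) lte01.
by have := cos2Dsin2 (2 * pi * l * x); rewrite c0 s0 expr0n addr0 => /esym/eqP;
  rewrite oner_eq0.
Qed.

(** The constant 1, which is [expo 0], would be orthogonal to an empty family. *)
Lemma spectrum_nonempty rho Lam : complete_exp rho Lam -> exists l, Lam l.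
Proof.
move=> cmpl; apply: contrapT => /forallNP L0.
by apply: (@ae_zero_expo rho 0); apply: cmpl; [exact: cL2_expo|move=> l /L0].
Qed.

(* The pair on the left is the product f e_l0. *)
Lemma ip_shift rho f (l l0 : R) :
  ip rho (fun x => f.1 x * cos (2 * pi * l0 * x) - f.2 x * sin (2 * pi * l0 * x),
          fun x => f.1 x * sin (2 * pi * l0 * x) + f.2 x * cos (2 * pi * l0 * x))
    (expo l) = ip rho f (expo (l - l0)).
Proof.
rewrite /ip; congr pair; apply: eq_Rintegral => x _ /=;
  rewrite (_ : 2 * pi * (l - l0) * x = 2 * pi * l * x - 2 * pi * l0 * x);
  rewrite ?cosB ?sinB; ring.
Qed.

Lemma cL2_shift rho f (l0 : R) : cL2 rho f ->
  cL2 rho (fun x => f.1 x * cos (2 * pi * l0 * x) - f.2 x * sin (2 * pi * l0 * x),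
           fun x => f.1 x * sin (2 * pi * l0 * x) + f.2 x * cos (2 * pi * l0 * x)).
Proof.
move=> /cL2E[f1 f2].
have mc := measurable_cosl (2 * pi * l0); have ms := measurable_sinl (2 * pi * l0).
apply/cL2E; split; last first.
  by apply: L2D; apply: (@L2M_bounded _ _ _ _ 1) => // x; rewrite ?sin_max ?cos_max.
under [X in L2 _ X]eq_fun do rewrite -mulrN.
apply: L2D; apply: (@L2M_bounded _ _ _ _ 1) => //.
- by move=> x; exact: cos_max.
- exact: measurableT_comp.
- by move=> x; rewrite normrN; exact: sin_max.
Qed.

(** Orthogonality depends on differences of frequencies only, and multiplication by the unimodular
    [expo l0] carries completeness over to the spectrum translated by - l0. *)
Lemma spectral_with0 rho : spectral rho ->
  exists Lam, [/\ countable Lam, Lam 0, orthonormal_exp rho Lam &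
                  complete_exp rho Lam].
Proof.
move=> [Lam [Lc [/orthonormal_expP on cmpl]]].
have [l0 Ll0] := spectrum_nonempty cmpl.
exists [set l - l0 | l in Lam]; split.
- exact: sub_countable (card_image_le _ _) Lc.
- by exists l0 => //; rewrite subrr.
- apply/orthonormal_expP => _ _ [l Ll <-] [l' Ll' <-] ll'.
  rewrite (_ : l - l0 - (l' - l0) = l - l'); last by ring.
  by apply: on => //; apply: contra_neq ll' => ->.
- move=> f f2 fL; have := cmpl _ (cL2_shift l0 f2).
  have /[swap]/[apply] : forall l, Lam l -> _ := fun l Ll => etrans (ip_shift rho f l l0) (fL _ (imageP _ Ll)).
  apply: filterS => x /= [h1 h2].
  (* Multiplying by the conjugate of [expo l0] recovers f at x. *)
  have cs := cos2Dsin2 (2 * pi * l0 * x).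
  set c := cos _ in h1 h2 cs; set s := sin _ in h1 h2 cs; split.
    transitivity ((f.1 x * c - f.2 x * s) * c + (f.1 x * s + f.2 x * c) * s).
      by rewrite -[LHS]mulr1 -cs; ring.
    by rewrite h1 h2 !mul0r addr0.
  transitivity ((f.1 x * s + f.2 x * c) * c - (f.1 x * c - f.2 x * s) * s).
    by rewrite -[LHS]mulr1 -cs; ring.
  by rewrite h1 h2 !mul0r subr0.
Qed.

End exponentials.

(** * Convolution with a discrete measure *)

Section convolution.
Context {R : realType} (nu eta mu : probability R R) (q : nat) (C : seq nat) (p : nat -> R).
Hypothesis q_gt0 : (0 < q)%N.
Hypothesis C_uniq : uniq C.
Hypothesis p_gt0 : forall c, c \in C -> 0 < p c.
Hypothesis etaE : forall A, measurable A ->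
  eta A = (\sum_(c <- C) (p c)%:E * \d_(c%:R : R) A)%E.
Hypothesis muE : forall A, measurable A ->
  mu A = (\sum_(c <- C) (p c)%:E * translate nu (q * c)%:R A)%E.
Implicit Types (f g : cfun R).

Let q_neq0 : (q%:R : R) != 0. Proof. by rewrite pnatr_eq0 -lt0n. Qed.

Lemma eta_L1 u : measurable_fun setT u -> L1 eta u.
Proof. by move=> mu_; apply/(mixture_L1 p_gt0 etaE) => // c _; exact: L1_dirac. Qed.

Lemma eta_Rint u : measurable_fun setT u ->
  Rintegral eta setT u = \sum_(c <- C) p c * u c%:R.
Proof.
move=> mu_; rewrite (mixture_Rint p_gt0 etaE); last exact: eta_L1.
by apply: eq_bigr => c _; rewrite Rint_dirac.
Qed.

(** Every atom has positive mass, so a null set contains none of them. *)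
Lemma eta_ae0 f : ae_zero eta f -> forall c, c \in C -> f.1 c%:R = 0 /\ f.2 c%:R = 0.
Proof.
move=> [N [mN N0 subN]] c cC; apply: contrapT => nf.
have Nc : N c%:R by exact: subN.
have /eqP := etrans (esym (etaE mN)) N0; rewrite gt_eqF// (big_rem c)//= diracE mem_set// mule1.
apply: (@lt_le_trans _ _ (p c)%:E); first by rewrite lte_fin p_gt0.
rewrite leeDl// big_seq; apply: sume_ge0 => d /mem_rem dC.
by rewrite mule_ge0// lee_fin (ltW (p_gt0 dC)).
Qed.

Lemma ae0_eta f : (forall c, c \in C -> f.1 c%:R = 0 /\ f.2 c%:R = 0) ->
  measurable_fun setT f.1 -> measurable_fun setT f.2 -> ae_zero eta f.
Proof.
move=> f0 mf1 mf2; pose Z := f.1 @^-1` [set 0] `&` f.2 @^-1` [set 0].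
have mZ : measurable Z.
  apply: measurableI; rewrite -[X in measurable X]setTI.
    by apply: mf1 => //; exact: measurable_set1.
  by apply: mf2 => //; exact: measurable_set1.
exists (~` Z); split; first exact: measurableC.
  apply: (etrans (etaE (measurableC mZ))); rewrite big_seq; apply: big1 => c cC; rewrite diracE memNset ?mule0//.
  by move=> nZ; apply: nZ; exact: f0.
by move=> x /= nx [Z1 Z2]; apply: nx.
Qed.

Lemma mu_L1 u : L1 mu u -> forall c, c \in C -> L1 nu (fun y : R => u (y + (q * c)%:R)).
Proof.
move=> u1 c cC; have mu_ := L1_measurable u1; apply/L1_translate => //.
by apply: (mixture_L1 p_gt0 muE mu_).1.
Qed.

Lemma mu_Rint u : L1 mu u -> Rintegral mu setT u =
  \sum_(c <- C) p c * Rintegral nu setT (fun y : R => u (y + (q * c)%:R)).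
Proof.
move=> u1; have mu_ := L1_measurable u1.
rewrite (mixture_Rint p_gt0 muE)// big_seq [RHS]big_seq; apply: eq_bigr => c cC.
by rewrite Rint_translate//; exact: (mixture_L1 p_gt0 muE mu_).1.
Qed.

Lemma eta_ip g (l : R) : measurable_fun setT g.1 -> measurable_fun setT g.2 ->
  ip eta g (expo l) =
  (\sum_(c <- C) p c * (g.1 c%:R * cos (2 * pi * l * c%:R) + g.2 c%:R * sin (2 * pi * l * c%:R)),
   \sum_(c <- C) p c * (g.2 c%:R * cos (2 * pi * l * c%:R) - g.1 c%:R * sin (2 * pi * l * c%:R))).
Proof.
move=> m1 m2; have mc := measurable_cosl (2 * pi * l).
have ms := measurable_sinl (2 * pi * l).
by rewrite /ip; congr pair; rewrite eta_Rint//;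
  [apply: measurable_funD|apply: measurable_funB]; exact: measurable_funM.
Qed.

(** The atoms are integers, where an exponential of integer frequency equals 1: frequencies matter
    to eta only modulo 1. *)
Lemma eta_ip_int g (l : R) (z : int) : measurable_fun setT g.1 -> measurable_fun setT g.2 ->
  ip eta g (expo (l + z%:~R)) = ip eta g (expo l).
Proof.
move=> m1 m2; rewrite !eta_ip//.
have E (c : nat) : 2 * pi * (l + z%:~R) * c%:R =
    2 * pi * l * c%:R + 2 * pi * (z * c%:Z)%:~R :> R by rewrite intrM; ring.
by congr pair; apply: eq_bigr => c _; rewrite E cos_int sin_int.
Qed.

Lemma fourier_eta_int (l : R) (z : int) : fourier eta (l + z%:~R) = fourier eta l.
Proof.
have [m1 [m2 _]] := cL2_expo eta 0.
rewrite -[l + _]opprK -sub0r -ip_expo opprD -mulrNz.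
by rewrite eta_ip_int// ip_expo sub0r opprK.
Qed.

(* F is the conditional expectation of g(c) f(y) given q c + y, under eta x nu. *)
Lemma tensor f g : supp nu `<=` [set x : R | 0 <= x <= 1] ->
  cL2 nu f -> measurable_fun setT g.1 -> measurable_fun setT g.2 ->
  exists F, [/\ cL2 mu F,
    forall l, ip mu F (expo l) = cmul (ip eta g (expo (q%:R * l))) (ip nu f (expo l)) &
    ae_zero mu F -> ae_zero eta g \/ ae_zero nu f].
Proof.
move=> snu /cL2E[f1 f2] mg1 mg2.
(* [u1 c] and [u2 c] are the real and imaginary parts of p_c g(c) f(y). *)
pose u1 c (y : R) := f.1 y * (p c * g.1 c%:R) + f.2 y * - (p c * g.2 c%:R).
pose u2 c (y : R) := f.2 y * (p c * g.1 c%:R) + f.1 y * (p c * g.2 c%:R).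
have u1L c : c \in C -> L2 nu (u1 c) by move=> _; apply: L2D; exact: L2Z.
have u2L c : c \in C -> L2 nu (u2 c) by move=> _; apply: L2D; exact: L2Z.
have [F1 F1L F1E] := transfer p_gt0 muE u1L.
have [F2 F2L F2E] := transfer p_gt0 muE u2L.
exists (F1, F2); split; first exact/cL2E.
- move=> l; rewrite /cmul eta_ip// /ip /=.
  have mc := measurable_cosl (2 * pi * l); have ms := measurable_sinl (2 * pi * l).
  have bint (rho : probability R R) (w h : R -> R) : L2 rho w -> measurable_fun setT h ->
      (forall x, `|h x| <= 1) -> L1 rho (fun x => w x * h x).
    by move=> w2 mh h1; apply: (@L1M_bounded _ _ _ _ 1) => //; exact: L2_L1.
  have cm (x : R) : `|cos (2 * pi * l * x)| <= 1 by exact: cos_max.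
  have sm (x : R) : `|sin (2 * pi * l * x)| <= 1 by exact: sin_max.
  rewrite RintegralD//; [|exact: bint|exact: bint].
  rewrite RintegralB//; [|exact: bint|exact: bint].
  rewrite !(F1E _ 1)// !(F2E _ 1)// [in RHS]RintegralD//; [|exact: bint|exact: bint].
  rewrite [in RHS]RintegralB//; [|exact: bint|exact: bint].
  set A := Rintegral nu setT (fun x => f.1 x * cos _).
  set B := Rintegral nu setT (fun x => f.2 x * sin _).
  set A' := Rintegral nu setT (fun x => f.2 x * cos _).
  set B' := Rintegral nu setT (fun x => f.1 x * sin _).
  have E (c : nat) (y : R) : 2 * pi * l * (y + (q * c)%:R) =
    2 * pi * l * y + 2 * pi * (q%:R * l) * c%:R by rewrite natrM; ring.
  (* After the addition formulas, every integrand is a combination of these four functions with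
     coefficients independent of y. *)
  pose wA y := f.1 y * cos (2 * pi * l * y); pose wB y := f.2 y * sin (2 * pi * l * y).
  pose wA' y := f.2 y * cos (2 * pi * l * y); pose wB' y := f.1 y * sin (2 * pi * l * y).
  have lin (h : R -> R) (a b a' b' : R) :
      (forall y, h y = a * wA y + b * wB y + (a' * wA' y + b' * wB' y)) ->
      Rintegral nu setT h = a * A + b * B + (a' * A' + b' * B').
    move=> hE; have iA : L1 nu wA by exact: bint.
    have iB : L1 nu wB by exact: bint.
    have iA' : L1 nu wA' by exact: bint.
    have iB' : L1 nu wB' by exact: bint.
    under eq_Rintegral do rewrite hE.
    rewrite !RintegralD//; try (by do ?apply: L1D; exact: L1Z).
    by rewrite !RintegralZl.
  have ang c (y : R) : cos (2 * pi * l * (y + (q * c)%:R)) =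
      cos (2 * pi * l * y) * cos (2 * pi * (q%:R * l) * c%:R) -
      sin (2 * pi * l * y) * sin (2 * pi * (q%:R * l) * c%:R) by rewrite E cosD.
  have ans c (y : R) : sin (2 * pi * l * (y + (q * c)%:R)) =
      sin (2 * pi * l * y) * cos (2 * pi * (q%:R * l) * c%:R) +
      cos (2 * pi * l * y) * sin (2 * pi * (q%:R * l) * c%:R) by rewrite E sinD.
  pose k c : R := cos (2 * pi * (q%:R * l) * c%:R).
  pose m c : R := sin (2 * pi * (q%:R * l) * c%:R).
  pose G1 c := p c * g.1 c%:R; pose G2 c := p c * g.2 c%:R.
  congr pair; rewrite !mulr_suml -?sumrB -?big_split/=; apply: eq_bigr => c _.
    rewrite (@lin _ (G1 c * k c) (G2 c * m c) (- (G2 c * k c)) (- (G1 c * m c))); last first.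
      by move=> y; rewrite /u1 ang /wA /wB /wA' /wB' /G1 /G2 /k /m; ring.
    rewrite (@lin _ (G2 c * m c) (G1 c * k c) (G1 c * m c) (G2 c * k c)); last first.
      by move=> y; rewrite /u2 ans /wA /wB /wA' /wB' /G1 /G2 /k /m; ring.
    by rewrite -/(k c) -/(m c) /G1 /G2; ring.
  rewrite (@lin _ (G2 c * k c) (- (G1 c * m c)) (G1 c * k c) (- (G2 c * m c))); last first.
    by move=> y; rewrite /u2 ang /wA /wB /wA' /wB' /G1 /G2 /k /m; ring.
  rewrite (@lin _ (G1 c * m c) (- (G2 c * k c)) (- (G2 c * m c)) (G1 c * k c)); last first.
    by move=> y; rewrite /u1 ans /wA /wB /wA' /wB' /G1 /G2 /k /m; ring.
  by rewrite -/(k c) -/(m c) /G1 /G2; ring.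
move=> F0.
(* [P] selects the atoms where g is nonzero. If there is none, g vanishes for eta; otherwise f has
   to vanish. *)
pose P (c : nat) := (c \in C) && ((g.1 c%:R != 0) || (g.2 c%:R != 0)).
have nP c : c \in C -> ~~ P c -> g.1 c%:R = 0 /\ g.2 c%:R = 0.
  by rewrite /P => -> /=; rewrite negb_or !negbK => /andP[/eqP-> /eqP->].
have [exP|noP] := pselect (exists c : nat, P c); last first.
  left; apply: ae0_eta => // c cC; apply: nP => //; apply/negP => Pc.
  by apply: noP; exists c.
right.
(* S is ]0, +oo[ for the largest c0 in P, and ]-oo, 1[ for the smallest. *)
have cancel c0 (S : set R) : P c0 -> measurable S ->
    (forall c, P c -> c != c0 -> {ae nu, forall y, ~ S (y + (q * c)%:R - (q * c0)%:R)}) ->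
    {ae nu, forall y, S y -> f.1 y = 0 /\ f.2 y = 0}.
  move=> Pc0 mS other; have /andP[c0C gc0] := Pc0.
  (* Stated for a generic pair of u and F, so as to serve both the real and the imaginary part. *)
  have zero (u : nat -> R -> R) (F : R -> R) : (forall c, c \in C -> L2 nu (u c)) ->
      (forall c y, c \in C -> ~~ P c -> u c y = 0) ->
      L2 mu F -> {ae mu, forall x, F x = 0} ->
      (forall (h : R -> R) k, measurable_fun setT h -> (forall x, `|h x| <= k) ->
        Rintegral mu setT (fun x => F x * h x) =
        \sum_(c <- C) Rintegral nu setT (fun y => u c y * h (y + (q * c)%:R))) ->
      {ae nu, forall y, S y -> u c0 y = 0}.
    move=> uL un [mF _] Fz FE.
    apply: (translates_cancel C_uniq _ _ c0C mS (t := fun c => (q * c)%:R)).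
    - by move=> c cC; exact/L2_L1/uL.
    - move=> B mB; rewrite -(FE (\1_B) 1)//.
        apply: ae_Rint0; first exact: measurable_funM.
        by apply: filterS Fz => x ->; rewrite mul0r.
      by move=> x; rewrite indicE; case: (_ \in _); rewrite ?normr1 ?normr0.
    - move=> c cC cc0; have [Pc|nPc] := boolP (P c).
        by apply: filterS (other c Pc cc0) => y; right.
      by apply: aeW => y; left; exact: un.
  have z1 := zero u1 F1 u1L _ F1L _ F1E; have z2 := zero u2 F2 u2L _ F2L _ F2E.
  have {}z1 : {ae nu, forall y, S y -> u1 c0 y = 0}.
    apply: z1; last by apply: filterS F0 => x [].
    by move=> c y cC /(nP _ cC)[g1 g2]; rewrite /u1 g1 g2; ring.
  have {}z2 : {ae nu, forall y, S y -> u2 c0 y = 0}.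
    apply: z2; last by apply: filterS F0 => x [].
    by move=> c y cC /(nP _ cC)[g1 g2]; rewrite /u2 g1 g2; ring.
  apply: filterS2 z1 z2 => y e1 e2 Sy; move: (e1 Sy) (e2 Sy).
  rewrite /u1 /u2 => {}e1 {}e2.
  (* The complex number p_c0 g(c0) is nonzero, and its product with f(y) is zero. *)
  have gz : (p c0 * g.1 c0%:R, p c0 * g.2 c0%:R) <> (0, 0).
    move=> [/eqP + /eqP]; rewrite !mulf_eq0 gt_eqF ?p_gt0//= => /eqP g1 /eqP g2.
    by move: gc0; rewrite g1 g2 eqxx.
  have /cmul_eq0[[-> ->]//|/gz//] :
    cmul (f.1 y, f.2 y) (p c0 * g.1 c0%:R, p c0 * g.2 c0%:R) = (0, 0).
  rewrite /cmul/=; congr pair; first by rewrite -e1; ring.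
  by rewrite -e2; ring.
have Pbound c : P c -> (c <= \max_(d <- C) d)%N.
  by move=> /andP[cC _]; rewrite (big_rem c)//= leq_maxl.
have supp01 := ae_supp snu.
(* As q >= 1, distinct translates q c + [0, 1] share at most an endpoint. *)
have step (c d : nat) : (c < d)%N -> (q * c)%:R + 1 <= (q * d)%:R :> R.
  move=> cd; rewrite natr1 ler_nat (leq_trans _ (leq_mul (leqnn q) cd))//.
  by rewrite mulnS -[(q * c).+1]add1n leq_add2r.
have top : {ae nu, forall y, 0 < y -> f.1 y = 0 /\ f.2 y = 0}.
  case: (ex_maxnP exP Pbound) => c0 Pc0 maxc0.
  apply: (cancel c0 [set y | 0 < y]) => //.
    by rewrite (_ : [set _ | _] = `]0, +oo[%classic)//; apply/seteqP; split=> y;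
      rewrite /= in_itv/= andbT.
  (* For c < c0 and y <= 1, y + q c - q c0 <= y - 1 <= 0. *)
  move=> c Pc cc0; apply: filterS supp01 => y /andP[y0 y1] /=; apply/negP.
  rewrite -leNgt; have /step : (c < c0)%N by rewrite ltn_neqAle cc0 maxc0.
  by lra.
have bot : {ae nu, forall y, y < 1 -> f.1 y = 0 /\ f.2 y = 0}.
  case: (ex_minnP exP) => c0 Pc0 minc0.
  apply: (cancel c0 [set y | y < 1]) => //.
    by rewrite (_ : [set _ | _] = `]-oo, 1[%classic)//; apply/seteqP; split=> y;
      rewrite /= in_itv.
  (* For c > c0 and y >= 0, y + q c - q c0 >= y + 1 >= 1. *)
  move=> c Pc cc0; apply: filterS supp01 => y /andP[y0 y1] /=; apply/negP.
  rewrite -leNgt; have /step : (c0 < c)%N by rewrite ltn_neqAle eq_sym cc0 minc0.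
  by lra.
apply: filterS2 top bot => y ytop ybot.
by have [/ytop|y0] := ltP 0 y => //; apply: ybot; exact: le_lt_trans y0 ltr01.
Qed.

(** The phase at q c + y splits into a phase in c of frequency q xi and a phase in y of frequency
    xi. *)
Lemma fourier_mu (xi : R) :
  fourier mu xi = cmul (fourier eta (q%:R * xi)) (fourier nu xi).
Proof.
have mc := measurable_cosl (2 * pi * xi); have ms := measurable_sinl (2 * pi * xi).
have cb (rho : probability R R) : L1 rho (fun x => cos (2 * pi * xi * x)).
  by apply: (@L1_bounded _ _ _ 1) => // x; exact: cos_max.
have sb (rho : probability R R) : L1 rho (fun x => sin (2 * pi * xi * x)).
  by apply: (@L1_bounded _ _ _ 1) => // x; exact: sin_max.
have E (c : nat) (y : R) : 2 * pi * xi * (y + (q * c)%:R) =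
  2 * pi * xi * y + 2 * pi * (q%:R * xi) * c%:R by rewrite natrM; ring.
rewrite /fourier /cmul/= !mu_Rint// !eta_Rint; try exact: measurable_cosl;
  try exact: measurable_sinl.
rewrite !mulr_suml -sumrB -big_split/=; congr pair; apply: eq_bigr => c _.
  under eq_Rintegral do rewrite E cosD.
  rewrite RintegralB//; [|exact: L1Zr..].
  by rewrite !RintegralZr//; [ring|exact: sb|exact: cb].
under eq_Rintegral do rewrite E sinD.
rewrite RintegralD//; [|exact: L1Zr..].
by rewrite !RintegralZr//; [ring|exact: cb|exact: sb].
Qed.

Lemma fourier_mu_eq0 (xi : R) : fourier mu xi = (0, 0) <->
  fourier eta (q%:R * xi) = (0, 0) \/ fourier nu xi = (0, 0).
Proof. by rewrite fourier_mu; exact: cmul_eq0. Qed.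

(** * Analysis of L^2(mu) along the fibres c |-> q c + y *)

Definition fiber f (y : R) : cfun R :=
  (fun t => f.1 (q%:R * t + y), fun t => f.2 (q%:R * t + y)).

(** Only the values of [fiber f y] at the atoms t = c enter: this is a Fourier coefficient of f
    along the points q c + y. *)
Definition fiber_coef f (gam y : R) : R * R := ip eta (fiber f y) (expo gam).

(* e^(- 2 i pi gam y / q) times [fiber_coef f gam y] *)
Definition fiber_transform f (gam : R) : cfun R :=
  (fun y => (fiber_coef f gam y).1 * cos (2 * pi * (gam / q%:R) * y) +
            (fiber_coef f gam y).2 * sin (2 * pi * (gam / q%:R) * y),
   fun y => (fiber_coef f gam y).2 * cos (2 * pi * (gam / q%:R) * y) -
            (fiber_coef f gam y).1 * sin (2 * pi * (gam / q%:R) * y)).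

Lemma measurable_fiber f (y : R) : measurable_fun setT f.1 -> measurable_fun setT f.2 ->
  measurable_fun setT (fiber f y).1 /\ measurable_fun setT (fiber f y).2.
Proof.
have ma : measurable_fun setT (fun t : R => q%:R * t + y).
  by apply: measurable_funD => //; exact: measurable_funM.
by move=> m1 m2; split; [exact: (measurableT_comp m1)|exact: (measurableT_comp m2)].
Qed.

Lemma fiber_coefE f (gam y : R) : measurable_fun setT f.1 -> measurable_fun setT f.2 ->
  fiber_coef f gam y =
  (\sum_(c <- C) p c * (f.1 (y + (q * c)%:R) * cos (2 * pi * gam * c%:R) +
                        f.2 (y + (q * c)%:R) * sin (2 * pi * gam * c%:R)),
   \sum_(c <- C) p c * (f.2 (y + (q * c)%:R) * cos (2 * pi * gam * c%:R) -
                        f.1 (y + (q * c)%:R) * sin (2 * pi * gam * c%:R))).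
Proof.
move=> m1 m2; have [mf1 mf2] := measurable_fiber y m1 m2.
rewrite /fiber_coef eta_ip//=.
by congr pair; apply: eq_bigr => c _; rewrite natrM [q%:R * _ + _]addrC.
Qed.

(** The transform combines finitely many translates of f with bounded factors, and each translate is
    in L^2(nu) because p_c > 0. *)
Lemma cL2_fiber_transform f (gam : R) : cL2 mu f -> cL2 nu (fiber_transform f gam).
Proof.
move=> f2; have [m1 [m2 _]] := f2.
have {f2} [[_ f1] [_ f2]] := (cL2E mu f).1 f2.
have tr (u : R -> R) c : c \in C -> measurable_fun setT u -> L1 mu (fun x => u x ^+ 2) ->
    L2 nu (fun y => u (y + (q * c)%:R)).
  move=> cC mu_ u2; split; last exact: (mu_L1 u2 cC).
  exact: (measurableT_comp mu_ (measurable_translation _)).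
have H1 : L2 nu (fun y => (fiber_coef f gam y).1).
  under [X in L2 _ X]eq_fun do rewrite fiber_coefE//.
  apply: L2_sum => c cC; under [X in L2 _ X]eq_fun do rewrite mulrC.
  by apply: L2Z; apply: L2D; apply: L2Z; exact: tr.
have H2 : L2 nu (fun y => (fiber_coef f gam y).2).
  under [X in L2 _ X]eq_fun do rewrite fiber_coefE//.
  apply: L2_sum => c cC; under [X in L2 _ X]eq_fun do rewrite mulrC -mulrN.
  by apply: L2Z; apply: L2D; apply: L2Z; exact: tr.
have mc := measurable_cosl (2 * pi * (gam / q%:R)).
have ms := measurable_sinl (2 * pi * (gam / q%:R)).
apply/cL2E; split.
  by apply: L2D; apply: (@L2M_bounded _ _ _ _ 1) => // x; rewrite ?sin_max ?cos_max.
rewrite /fiber_transform /=; under [X in L2 _ X]eq_fun do rewrite -mulrN.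
apply: L2D; apply: (@L2M_bounded _ _ _ _ 1) => //.
- by move=> x; exact: cos_max.
- exact: measurableT_comp.
- by move=> x; rewrite normrN; exact: sin_max.
Qed.

(** At q c + y the frequency lam contributes only its phase at y, because q lam c is an integer,
    while gam / q contributes the phase of gam at c and that of gam / q at y. Summing over c first
    leaves the transform. *)
Lemma ip_fiber_transform f (lam gam : R) (z : int) : cL2 mu f -> q%:R * lam = z%:~R ->
  ip mu f (expo (lam + gam / q%:R)) = ip nu (fiber_transform f gam) (expo lam).
Proof.
move=> f2 lamz; have [m1 [m2 _]] := f2.
have {f2} [f1 f2] := (cL2E mu f).1 f2.
set l := lam + gam / q%:R.
have mc := measurable_cosl (2 * pi * l); have ms := measurable_sinl (2 * pi * l).
have cm (x : R) : `|cos (2 * pi * l * x)| <= 1 by exact: cos_max.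
have sm (x : R) : `|sin (2 * pi * l * x)| <= 1 by exact: sin_max.
have E (c : nat) (y : R) : 2 * pi * l * (y + (q * c)%:R) =
    (2 * pi * lam * y + 2 * pi * (gam / q%:R) * y) + 2 * pi * gam * c%:R
    + 2 * pi * (z * c%:Z)%:~R.
  rewrite intrM -lamz /l natrM; field; exact: q_neq0.
(* Integration over mu is integration over nu of the weighted sum along the fibre. *)
have swap (phi psi : R -> R) : L1 mu phi ->
    (forall y, psi y = \sum_(c <- C) p c * phi (y + (q * c)%:R)) ->
    Rintegral mu setT phi = Rintegral nu setT psi.
  move=> phi1 psiE; rewrite mu_Rint//; under [RHS]eq_Rintegral do rewrite psiE.
  rewrite Rint_sum; last by move=> c cC; apply: L1Z; exact: mu_L1 phi1 c cC.
  rewrite big_seq [RHS]big_seq; apply: eq_bigr => c cC.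
  by rewrite RintegralZl//; exact: (mu_L1 phi1 cC).
have bint (w h : R -> R) : L2 mu w -> measurable_fun setT h ->
    (forall x, `|h x| <= 1) -> L1 mu (fun x => w x * h x).
  by move=> w2 mh h1; apply: (@L1M_bounded _ _ _ _ 1) => //; exact: L2_L1.
have T1 y : (fiber_transform f gam).1 y =
    (\sum_(c <- C) p c * (f.1 (y + (q * c)%:R) * cos (2 * pi * gam * c%:R) +
       f.2 (y + (q * c)%:R) * sin (2 * pi * gam * c%:R))) * cos (2 * pi * (gam / q%:R) * y) +
    (\sum_(c <- C) p c * (f.2 (y + (q * c)%:R) * cos (2 * pi * gam * c%:R) -
       f.1 (y + (q * c)%:R) * sin (2 * pi * gam * c%:R))) * sin (2 * pi * (gam / q%:R) * y).
  by have /= [<- <-] := fiber_coefE gam y m1 m2.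
have T2 y : (fiber_transform f gam).2 y =
    (\sum_(c <- C) p c * (f.2 (y + (q * c)%:R) * cos (2 * pi * gam * c%:R) -
       f.1 (y + (q * c)%:R) * sin (2 * pi * gam * c%:R))) * cos (2 * pi * (gam / q%:R) * y) -
    (\sum_(c <- C) p c * (f.1 (y + (q * c)%:R) * cos (2 * pi * gam * c%:R) +
       f.2 (y + (q * c)%:R) * sin (2 * pi * gam * c%:R))) * sin (2 * pi * (gam / q%:R) * y).
  by have /= [<- <-] := fiber_coefE gam y m1 m2.
rewrite /ip; congr pair; apply: swap.
- by apply: L1D; exact: bint.
- move=> y; cbv beta; rewrite T1 T2 /= !mulr_suml -!sumrB -!big_split/=.
  rewrite !mulr_suml -big_split/=; apply: eq_bigr => c _.
  by rewrite E cos_int sin_int !(cosD, sinD); ring.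
- by apply: L1B; exact: bint.
- move=> y; cbv beta; rewrite T1 T2 /= !mulr_suml -!sumrB -!big_split/=.
  rewrite !mulr_suml -sumrB/=; apply: eq_bigr => c _.
  by rewrite E cos_int sin_int !(cosD, sinD); ring.
Qed.

(** The transform is the coefficient times a number of modulus 1, undone by multiplying with its
    conjugate. *)
Lemma fiber_transform0 f (gam y : R) :
  (fiber_transform f gam).1 y = 0 /\ (fiber_transform f gam).2 y = 0 ->
  fiber_coef f gam y = (0, 0).
Proof.
suff rot (z : R * R) (t : R) : z.1 * cos t + z.2 * sin t = 0 /\
    z.2 * cos t - z.1 * sin t = 0 -> z = (0, 0) by exact: rot.
case: z => a b /= [h1 h2].
set u := cos t in h1 h2; set v := sin t in h1 h2.
have uv : u ^+ 2 + v ^+ 2 = 1 by exact: cos2Dsin2.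
congr pair.
  transitivity ((a * u + b * v) * u - (b * u - a * v) * v).
    by rewrite -[LHS]mulr1 -uv; ring.
  by rewrite h1 h2 !mul0r subr0.
transitivity ((a * u + b * v) * v + (b * u - a * v) * u).
  by rewrite -[LHS]mulr1 -uv; ring.
by rewrite h1 h2 !mul0r addr0.
Qed.

(** The exceptional sets are indexed along an injection of [Lam] into the naturals, an index that is
    not hit giving the empty set. *)
Lemma ae_countable (Lam : set R) (P : R -> R -> Prop) : countable Lam ->
  (forall l, Lam l -> {ae nu, forall y, P l y}) ->
  {ae nu, forall y, forall l, Lam l -> P l y}.
Proof.
move=> /countable_injP[e einj] PL.
pose F n := [set y | exists l, [/\ Lam l, e l = n & ~ P l y]].
have Fneg n : nu.-negligible (F n).
  have [[l [Ll eln]]|nol] := pselect (exists l, Lam l /\ e l = n).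
    apply: negligibleS (PL l Ll) => y [l' [Ll' el'n nP]] /= Py; apply: nP.
    by rewrite (einj l' l) ?inE// el'n.
  apply: negligibleS (@negligible_set0 _ _ _ nu) => y [l [Ll eln _]].
  by apply: nol; exists l.
apply: negligibleS (negligible_bigcup Fneg) => y /= /existsNP[l /not_implyP[Ll nP]].
by exists (e l) => //; exists l.
Qed.

(** * The two implications *)

Lemma spectral_convolution :
  (forall xi : R, fourier nu xi = (0, 0) -> exists z : int, q%:R * xi = z%:~R) ->
  spectral eta -> spectral nu -> spectral mu.
Proof.
move=> Znu [Gam [Gc [/orthonormal_expP Gon Gcmpl]]].
move=> /spectral_with0[Lam [Lc L0 /orthonormal_expP Lon Lcmpl]].
(* As 0 is in [Lam], every other l = l - 0 is itself a zero of the transform of nu. *)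
have LamZ l : Lam l -> exists z : int, q%:R * l = z%:~R.
  move=> Ll; have [->|l0] := eqVneq l 0; first by exists 0; rewrite mulr0.
  by apply: Znu; have := Lon _ _ Ll L0 l0; rewrite subr0.
exists [set z.1 + z.2 / q%:R | z in Lam `*` Gam]; split; [|split].
- exact: sub_countable (card_image_le _ _) (countableX Lc Gc).
- apply/orthonormal_expP => _ _ [[l g] [/= Ll Gg] <-] [[l' g'] [/= Ll' Gg'] <-] neq.
  (* With equal second components the difference lies in Lam - Lam; otherwise q times it is g - g'
     up to an integer, which eta does not see. *)
  apply/fourier_mu_eq0; have [gg'|gg'] := eqVneq g g'.
    right; rewrite gg' [X in fourier _ X](_ : _ = l - l'); last by ring.
    by apply: Lon => //; apply: contra_neq neq => ->; rewrite gg'.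
  left; have [z zE] := LamZ l Ll; have [z' z'E] := LamZ l' Ll'.
  rewrite [X in fourier _ X](_ : _ = g - g' + (z - z')%:~R).
    by rewrite fourier_eta_int; exact: Gon.
  by rewrite intrB -zE -z'E; field; exact: q_neq0.
- move=> f f2 f0; have [m1 [m2 _]] := f2.
  have tr0 (g : R) : Gam g -> ae_zero nu (fiber_transform f g).
    move=> Gg; apply: Lcmpl; first exact: cL2_fiber_transform.
    move=> l Ll; have [z zE] := LamZ l Ll.
    by rewrite -(ip_fiber_transform _ f2 zE) f0//; exists (l, g).
  (* [Gam] is countable, so for almost every y all coefficients vanish at once, and completeness for
     eta kills f on the fibre over y. *)
  have fib : {ae nu, forall y, forall c, c \in C ->
      f.1 (y + (q * c)%:R) = 0 /\ f.2 (y + (q * c)%:R) = 0}.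
    have := ae_countable Gc tr0; apply: filterS => y y0 c cC.
    have [mf1 mf2] := measurable_fiber y m1 m2.
    have : ae_zero eta (fiber f y).
      apply: Gcmpl; last by move=> g Gg; exact: fiber_transform0 (y0 g Gg).
      by apply/cL2E; split; split=> //; apply: eta_L1; exact: measurable_funX.
    by move=> /eta_ae0 /(_ c cC)[]; rewrite /= -natrM addrC.
  pose Z := f.1 @^-1` [set 0] `&` f.2 @^-1` [set 0].
  have mZ : measurable (~` Z).
    apply: measurableC; apply: measurableI; rewrite -[X in measurable X]setTI.
      by apply: m1 => //; exact: measurable_set1.
    by apply: m2 => //; exact: measurable_set1.
  exists (~` Z); split => //.
  apply: (etrans (muE mZ)); rewrite big_seq; apply: big1 => c cC.
  suff -> : translate nu (q * c)%:R (~` Z) = 0%E by rewrite mule0.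
  have mtZ : measurable (translation (q * c)%:R @^-1` (~` Z)).
    by rewrite -[X in measurable X]setTI; exact: measurable_translation.
  apply: (negligibleP nu mtZ).1; apply: negligibleS fib => y /= nZ y0; apply: nZ.
  by have [] := y0 c cC.
Qed.

Lemma spectral_factors : supp nu `<=` [set x : R | 0 <= x <= 1] ->
  (forall xi : R, fourier nu xi = (0, 0) -> exists z : int, q%:R * xi = z%:~R) ->
  spectral mu -> spectral eta /\ spectral nu.
Proof.
move=> snu Znu [Lam [Lc [/orthonormal_expP Lon Lcmpl]]].
(* Congruence modulo Z / q, scaled by q. *)
pose cong (l l' : R) := exists z : int, q%:R * l = q%:R * l' + z%:~R.
have cong_sym l l' : cong l l' -> cong l' l.
  by move=> [z E]; exists (- z); rewrite E mulrNz addrK.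
have cong_trans l1 l2 l3 : cong l1 l2 -> cong l2 l3 -> cong l1 l3.
  by move=> [z E] [z' E']; exists (z' + z); rewrite E E' intrD addrA.
have ncong l l' : Lam l -> Lam l' -> ~ cong l l' ->
    fourier eta (q%:R * l - q%:R * l') = (0, 0).
  move=> Ll Ll' nc; have ll' : l != l'.
    by apply/eqP => ll'; apply: nc; exists 0; rewrite ll' addr0.
  have /fourier_mu_eq0[|/Znu[z zE]] := Lon _ _ Ll Ll' ll'; first by rewrite mulrBr.
  by case: nc; exists z; rewrite -zE; ring.
split.
  (* A representative in [Lam] of the class of l. The default 0 is never taken for l in [Lam], and
     congruent points get the same representative since [xget] sees the same set. *)
  pose r (l : R) : R := xget 0 [set l' | Lam l' /\ cong l l'].
  have rP l : Lam l -> Lam (r l) /\ cong l (r l).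
    move=> Ll; have : exists l', [set l' | Lam l' /\ cong l l'] l'.
      by exists l; split => //; exists 0; rewrite addr0.
    by move=> /(xgetPex 0).
  have r_eq l l' : cong l l' -> r l = r l'.
    move=> cl; congr xget; apply/seteqP; split=> x [Lx cx]; split=> //.
      exact: cong_trans (cong_sym _ _ cl) cx.
    exact: cong_trans cl cx.
  exists [set q%:R * r l | l in Lam]; split; [|split].
  - exact: sub_countable (card_image_le _ _) Lc.
  - apply/orthonormal_expP => _ _ [l Ll <-] [l' Ll' <-] neq.
    have [Lr cr] := rP l Ll; have [Lr' cr'] := rP l' Ll'.
    apply: ncong => // c; move/eqP: neq; apply; congr (_ * _).
    apply: r_eq; apply: (cong_trans _ (r l)) => //; apply: (cong_trans _ (r l')) => //.
    exact: cong_sym.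
  - move=> g /cL2E[[mg1 _] [mg2 _]] g0.
    (* Pairing g with the constant 1, which is not zero for nu, leaves g = 0 as the only
       alternative. *)
    have [F [F2 FE F0]] := tensor snu (cL2_expo nu 0) mg1 mg2.
    have /F0[//|/ae_zero_expo//] : ae_zero mu F.
    apply: Lcmpl => // l Ll; rewrite FE; apply/cmul_eq0; left.
    have [_ [z ->]] := rP l Ll; rewrite eta_ip_int//.
    by apply: g0; exists l.
(* A single class serves as spectrum of nu, that of an arbitrary l0. *)
have [l0 Ll0] := spectrum_nonempty Lcmpl.
exists [set l | Lam l /\ cong l l0]; split; [|split].
- by apply: sub_countable Lc; apply: subset_card_le => l [].
- apply/orthonormal_expP => l l' [Ll cl] [Ll' cl'] neq.
  have /fourier_mu_eq0[|//] := Lon _ _ Ll Ll' neq.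
  have [z zE] := cong_trans _ _ _ cl (cong_sym _ _ cl').
  (* Within a class the eta factor is evaluated at an integer, where it equals 1, so the nu factor
     has to vanish. *)
  rewrite (_ : q%:R * (l - l') = 0 + z%:~R); last by rewrite mulrBr zE; ring.
  by rewrite fourier_eta_int fourier0 => -[/eqP]; rewrite oner_eq0.
(* Here g is [expo (q%:R * l0)]: its inner product with the exponential of frequency q l vanishes
   for every l of [Lam] outside the class of l0. *)
- move=> f f2 f0; have [m1 [m2 _]] := cL2_expo eta (q%:R * l0).
  have [F [F2 FE F0]] := tensor snu f2 m1 m2.
  have /F0[/ae_zero_expo//|//] : ae_zero mu F.
  apply: Lcmpl => // l Ll; rewrite FE; apply/cmul_eq0.
  have [cl|ncl] := pselect (cong l l0); first by right; exact: f0.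
  by left; rewrite ip_expo; apply: ncong => // /cong_sym.
Qed.

End convolution.

Theorem theorem5p3 (R : realType) (nu : probability R R) (q : nat)
  (C : seq nat) (p : nat -> R) (eta etaq mu : probability R R) :
  supp nu `<=` [set x : R | 0 <= x <= 1] ->
  R_spectral nu ->
  (0 < q)%N ->
  (forall xi : R, fourier nu xi = (0, 0) -> exists z : int, q%:R * xi = z%:~R) ->
  uniq C ->
  (forall c, c \in C -> 0 < p c) ->
  \sum_(c <- C) p c = 1 ->
  (forall A, measurable A -> eta A = (\sum_(c <- C) (p c)%:E * \d_(c%:R : R) A)%E) ->
  (forall A, measurable A -> etaq A = (\sum_(c <- C) (p c)%:E * \d_((q * c)%:R : R) A)%E) ->
  (forall A, measurable A -> mu A = meas_conv etaq nu A) ->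
  (spectral mu <-> spectral eta /\ spectral nu).
Proof.
move=> snu _ q0 Znu uC p0 _ etaE etaqE muE.
have {}muE := meas_convE p0 etaqE muE.
split; first exact: (spectral_factors q0 uC p0 etaE muE snu Znu).
by case; exact: (spectral_convolution q0 p0 etaE muE Znu).
Qed.
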